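(* Let $p\geq 5$ be a prime and let $t$ be the unique integer with $1\leq t\leq p-1$ such that $24t+1\equiv 0\pmod p$. Then for all $n\geq 0$, $d_{p-2}(pn+t)\equiv 0\pmod p$.
   Context: For each integer $k\geq 1$, the numbers $d_k(n)$ are defined by $\sum_{n\geq 0} d_k(n)q^n = \frac{f_2^k}{f_1^{3k+1}}$, where $f_r = \prod_{i\geq 1}(1-q^{ri})$. *)

(* Defs.v *)
From mathcomp Require Import all_boot all_order all_algebra.
Set Implicit Arguments. Unset Strict Implicit. Unset Printing Implicit Defensive.
Import GRing.Theory Num.Theory.
Local Open Scope ring_scope.

(* Truncation of f_r = prod_{i>=1} (1 - q^{r i}) to the factors i <= N.
   Factors with i > N only affect coefficients of degree > N (r >= 1). *)
Definition fr_trunc (r N : nat) : {poly int} :=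
  \prod_(1 <= i < N.+1) (1 - 'X^(r * i)).

(* d_k(n) = [q^n] f_2^k / f_1^{3k+1}.  Writing g = f_1^{3k+1} (constant term 1),
   1/g = sum_{j>=0} (1 - g)^j, and (1 - g)^j has order >= j, so only j <= n
   matter for the coefficient of q^n. *)
Definition d (k n : nat) : int :=
  ((fr_trunc 2 n) ^+ k *
   \sum_(j < n.+1) (1 - (fr_trunc 1 n) ^+ (3 * k + 1)) ^+ j)`_n.

(* Main.v *)
Require Import Defs.
From mathcomp Require Import all_boot all_order all_algebra.
From mathcomp Require Import zify ring.
Set Implicit Arguments. Unset Strict Implicit. Unset Printing Implicit Defensive.
Import GRing.Theory Num.Theory.
Local Open Scope ring_scope.

(* Modulo [p], the generating function [f_2^(p-2) / f_1^(3p-5)] equals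
   [(f_2^p / f_1^(3p)) * (f_1^5 / f_2^2)]. By Frobenius the first factor is a
   series in [q^p], and the second one is [sum_j (6j+1) q^(j(3j+1)/2)]. An
   exponent [N = j(3j+1)/2] satisfies [24 N + 1 = (6j+1)^2], so for
   [24 N + 1 = 0] mod [p] its coefficient [6j+1] vanishes mod [p].

   The formula for [f_1^5 / f_2^2] is the quintuple product identity
   differentiated at [z = 1]. It follows from Jacobi's series for [f_1^3],
   Gauss's series for [f_1^2 / f_2] and Euler's series for [f_2]: a term of
   the double series for [f_1^3 * f_1^2 / f_2] with indices [(m, n)] is
   reindexed by the residue of [m + 2n] mod 3; one class cancels and the other
   two factor as [f_2] times the wanted series. The three classical series come
   from finite identities in the style of Shanks, whose correction terms are
   multiples of [q^(n+1)]. *)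

(** * Finite forms of the series of Euler, Gauss and Jacobi *)

Lemma bin2S n : 'C(n.+1, 2) = ('C(n, 2) + n)%N.
Proof. by rewrite binS bin1. Qed.

Section FiniteIdentities.
Variables (R : comNzRingType) (q : R).

Definition qprod (a b : nat) : R := \prod_(a <= i < b) (1 - q ^+ i).

Lemma qprod_recl a b : (a < b)%N -> qprod a b = (1 - q ^+ a) * qprod a.+1 b.
Proof. by move=> ab; rewrite /qprod big_ltn. Qed.

Lemma qprod_recr a b : (a <= b)%N -> qprod a b.+1 = qprod a b * (1 - q ^+ b).
Proof. by move=> ab; rewrite /qprod big_nat_recr. Qed.

Lemma qprod_nil a b : (b <= a)%N -> qprod a b = 1.
Proof. by move=> ba; rewrite /qprod big_geq. Qed.

Lemma qprod0 b : (0 < b)%N -> qprod 0 b = 0.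
Proof. by move=> b0; rewrite qprod_recl // expr0 subrr mul0r. Qed.

(** Shanks's summand, with the quotient of [qprod 1 n.+1] by [qprod 1 s.+1] written without
    division. The term [s = 0] is the full product; every other one carries at least [q ^+ n.+1]. *)
Definition euler_term (n s : nat) : R :=
  (-1) ^+ s * q ^+ (s * n + 'C(s.+1, 2)) * qprod s.+1 n.+1.

(** The boundary term vanishes at [J = 0] through [1 - q ^+ 0]. At [J = n.+1] it is one of the two
    pentagonal terms gained in passing from [n] to [n.+1]; the other is the new top summand. *)
Lemma euler_term_telescope n J : (J <= n.+1)%N ->
  \sum_(s < J) euler_term n.+1 s = \sum_(s < J) euler_term n s
    + (-1) ^+ J * q ^+ (J * n + 'C(J.+1, 2)) * qprod J n.+1.
Proof.
elim: J => [|J IH] hJ; first by rewrite !big_ord0 qprod0 // mulr0 addr0.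
rewrite !big_ord_recr /= (IH (ltnW hJ)) /euler_term (@qprod_recr J.+1 n.+1) //.
rewrite (@qprod_recl J n.+1) // (bin2S J.+1).
have -> : (J.+1 * n + ('C(J.+1, 2) + J.+1) = (J * n + 'C(J.+1, 2)) + J + n.+1)%N by lia.
have -> : (J * n.+1 + 'C(J.+1, 2) = J * n + 'C(J.+1, 2) + J)%N by lia.
rewrite !(exprD q) (exprS (-1)); ring.
Qed.

Lemma euler_finite n :
  \sum_(s < n.+1) euler_term n s =
    \sum_(i < n.+1) (-1) ^+ i * q ^+ (i * i + 'C(i.+1, 2))
    + \sum_(i < n) (-1) ^+ i.+1 * q ^+ (i.+1 * i.+1 + 'C(i.+1, 2)).
Proof.
elim: n => [|n IH].
  by rewrite !big_ord_recr !big_ord0 /= /euler_term /= qprod_nil ?mulr1 ?addr0.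
rewrite big_ord_recr /= euler_term_telescope // IH.
rewrite [\sum_(i < n.+2) _]big_ord_recr /= [\sum_(i < n.+1) (-1) ^+ i.+1 * _]big_ord_recr /=.
rewrite /euler_term !qprod_nil // !mulr1.
have -> : (n.+1 * n + 'C(n.+2, 2) = n.+1 * n.+1 + 'C(n.+1, 2))%N by rewrite (bin2S n.+1); lia.
ring.
Qed.

Definition qprodN (a b : nat) : R := \prod_(a <= i < b) (1 + q ^+ i).

(* Only [s >= 1] is meaningful: for [s = 0] the empty product would have to be
   one half, which is why the initial term of [gauss_finite] has no factor 2. *)
Definition gauss_term (n s : nat) : R :=
  (-1) ^+ s * q ^+ (s * n.+1) * qprod s.+1 n.+1 * qprodN 1 s.

(** At [J = n] the boundary term and the new top summand combine into a factor [1 + q ^+ n.+1],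
    which extends [qprodN 1 n.+1] and leaves the next square power. *)
Lemma gauss_term_telescope n J : (J <= n)%N ->
  qprod 1 n.+2 + (\sum_(s < J) gauss_term n.+1 s.+1) *+ 2 =
  (1 + q ^+ n.+1) * (qprod 1 n.+1 + (\sum_(s < J) gauss_term n s.+1) *+ 2)
  + ((-1) ^+ J.+1 * q ^+ (J.+1 * n.+1) * qprod J.+1 n.+1 * qprodN 1 J.+1) *+ 2.
Proof.
elim: J => [|J IH] hJ.
  rewrite !big_ord0 !mul0rn !addr0 qprod_recr // mul1n.
  rewrite /qprodN big_geq //; ring.
have := IH (ltnW hJ) => {}IH.
rewrite !big_ord_recr /= !mulrnDl addrA IH /gauss_term.
rewrite (@qprod_recr J.+2 n.+1) // (@qprod_recl J.+1 n.+1) //.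
have -> : qprodN 1 J.+2 = qprodN 1 J.+1 * (1 + q ^+ J.+1) by rewrite /qprodN big_nat_recr.
have -> : (J.+1 * n.+2 = J.+1 * n.+1 + J.+1)%N by lia.
have -> : (J.+2 * n.+1 = J.+1 * n.+1 + n.+1)%N by lia.
rewrite !(exprD q) !(exprS (-1)); ring.
Qed.

Lemma gauss_finite n :
  qprod 1 n.+1 + (\sum_(s < n) gauss_term n s.+1) *+ 2 =
    qprodN 1 n.+1 * (\sum_(i < n.+1) (-1) ^+ i * q ^+ (i * i)
      + \sum_(i < n) (-1) ^+ i.+1 * q ^+ (i.+1 * i.+1)).
Proof.
elim: n => [|n IH].
  by rewrite !big_ord_recr !big_ord0 /= qprod_nil // /qprodN big_geq //=; ring.
rewrite big_ord_recr /= mulrnDl addrA gauss_term_telescope // IH.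
rewrite [\sum_(i < n.+2) _]big_ord_recr /= [\sum_(i < n.+1) (-1) ^+ i.+1 * _]big_ord_recr /=.
rewrite /gauss_term !qprod_nil //.
have -> : qprodN 1 n.+2 = qprodN 1 n.+1 * (1 + q ^+ n.+1) by rewrite /qprodN big_nat_recr.
have -> : (n.+1 * n.+2 = n.+1 * n.+1 + n.+1)%N by lia.
rewrite !(exprD q); ring.
Qed.

(* This is the Gaussian binomial coefficient [2n+1 choose n-j] multiplied by
   [(1 - q) ... (1 - q^n)]; it vanishes for [j = n + 1], through the factor
   [1 - q^0]. *)
Definition jacobi_coef (n j : nat) : R :=
  qprod (n.+1 - j) n.+1 * qprod (n + j).+2 (n + n).+2.

(** The q-Pascal rule applied twice, once in each of its two forms, lowers [2n+3 choose n-j] to the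
    upper index 2n+1; the factor [1 - q ^+ n.+1] adjusts the normalization. *)
Lemma jacobi_coef_rec n j : (j < n)%N ->
  jacobi_coef n.+1 j.+1 = (1 - q ^+ n.+1) *
    ((1 + q ^+ n.+1 * q ^+ n.+1) * jacobi_coef n j.+1
     + q ^+ (n - j) * jacobi_coef n j + q ^+ (n + j).+3 * jacobi_coef n j.+2).
Proof.
move=> jn; rewrite /jacobi_coef.
have -> : (n.+2 - j.+1 = (n - j).+1)%N by lia.
have -> : (n.+1 - j.+1 = n - j)%N by lia.
have -> : (n.+1 - j = (n - j).+1)%N by lia.
have -> : (n.+1 - j.+2 = (n - j).-1)%N by lia.
rewrite (@qprod_recr (n - j).+1 n.+1) ?(@qprod_recl (n - j).-1) ?(@qprod_recl (n - j) n.+1); try lia.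
have -> : ((n - j).-1.+1 = n - j)%N by lia.
rewrite ?(@qprod_recl (n - j) n.+1); try lia.
have -> : ((n.+1 + j.+1).+2 = (n + j).+4)%N by lia.
have -> : ((n + j.+1).+2 = (n + j).+3)%N by lia.
have -> : ((n + j.+2).+2 = (n + j).+4)%N by lia.
have -> : ((n.+1 + n.+1).+2 = (n + n).+4)%N by lia.
(* For [j = n - 1] the last coefficient vanishes through [1 - q ^+ 0], and its second product is
   empty, so the common factor used below cannot be split off. *)
have [jn1|jn1] := leqP j.+2 n; last first.
  have -> : j = n.-1 by lia.
  case: n jn {jn1} => // n _ /=.
  have -> : (n.+1 - n = 1)%N by lia.
  rewrite (@qprod_recr (n.+1 + n).+4) ?(@qprod_recl (n.+1 + n).+2 (n.+1 + n.+1).+2); try lia.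
  rewrite ?(@qprod_nil (n.+1 + n).+4) ?(@qprod_nil (n.+1 + n).+3); try lia.
  have -> : ((n.+1 + n.+1).+3 = 1 + n.+2 + n.+2)%N by lia.
  have -> : ((n.+1 + n).+3 = n.+2 + n.+2)%N by lia.
  have -> : ((n.+1 + n).+2 = n.+1 + n.+2)%N by lia.
  rewrite !exprD (exprS q n.+1) !expr1 expr0.
  ring.
rewrite (@qprod_recr (n + j).+4 (n + n).+3) ?(@qprod_recr (n + j).+4 (n + n).+2); try lia.
rewrite (@qprod_recl (n + j).+2) ?(@qprod_recl (n + j).+3); try lia.
have -> : ((n + n).+3 = 1 + (n.+1 + n.+1))%N by lia.
have -> : ((n + n).+2 = n.+1 + n.+1)%N by lia.
(* The powers of [q] left are not independent; [ring] closes the goal only modulo this relation. *)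
have : q ^+ n.+1 * q ^+ n.+1 = q * q ^+ (n - j).-1 * q ^+ (n + j).+2.
  by rewrite -!exprD -exprS -exprD; congr (q ^+ _); lia.
have -> : (n - j = (n - j).-1.+1)%N by lia.
rewrite /= !exprD expr1 => ->.
rewrite (exprS q (n - j).-1) (exprS q (n + j).+2).
ring.
Qed.

(** The case of [jacobi_coef_rec] where the index [j] is -1: by the symmetry of Gaussian binomials
    the coefficient at -1 equals the one at 0. *)
Lemma jacobi_coef_rec0 n :
  jacobi_coef n.+2 0 = (1 - q ^+ n.+2) *
    ((1 + q ^+ n.+2 * q ^+ n.+2) * jacobi_coef n.+1 0
     + q ^+ n.+2 * jacobi_coef n.+1 0 + q ^+ n.+3 * jacobi_coef n.+1 1).
Proof.
rewrite /jacobi_coef !subn0 !addn0 !(@qprod_nil _ _ (leqnn _)) !mul1r subn1 /=.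
have -> : ((n.+2 + n.+2).+2 = (n + n).+3.+3)%N by lia.
have -> : ((n.+1 + n.+1).+2 = (n + n).+4)%N by lia.
have -> : ((n.+1 + 1).+2 = n.+4)%N by lia.
rewrite (@qprod_recl n.+1 n.+2) // (@qprod_nil n.+2 n.+2) //.
rewrite (@qprod_recr n.+4 (n + n).+3.+2) ?(@qprod_recr n.+4 (n + n).+4); try lia.
rewrite (@qprod_recl n.+3); try lia.
have -> : ((n + n).+3.+2 = 1 + (n.+2 + n.+2))%N by lia.
have -> : ((n + n).+4 = n.+2 + n.+2)%N by lia.
rewrite !exprD !(exprS q n.+2) (exprS q n.+1) expr1.
ring.
Qed.

Definition jacobi_term (n j : nat) : R :=
  (-1) ^+ j * q ^+ 'C(j.+1, 2) * jacobi_coef n j.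

Lemma jacobi_term_telescope n J : (J <= n.+1)%N ->
  \sum_(j < J.+1) jacobi_term n.+2 j *+ (2 * j + 1) =
  (1 - q ^+ n.+2) ^+ 3 * (\sum_(j < J.+1) jacobi_term n.+1 j *+ (2 * j + 1))
  + (1 - q ^+ n.+2) * q ^+ n.+2 *
    (jacobi_term n.+1 J *+ (2 * J + 3) - jacobi_term n.+1 J.+1 *+ (2 * J + 1)).
Proof.
elim: J => [|J IH] hJ.
  rewrite !big_ord_recr !big_ord0 /= /jacobi_term jacobi_coef_rec0 !binS !bin1 !bin0 /=.
  rewrite !bin_small // (exprS q n.+2); ring.
rewrite big_ord_recr /= (IH (ltnW hJ)) [in RHS]big_ord_recr /=.
set S := \sum_(_ < _) _.
rewrite /jacobi_term (@jacobi_coef_rec n.+1 J); last lia.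
have hn : q ^+ n.+2 = q ^+ (n.+1 - J) * q ^+ J.+1 by rewrite -exprD; congr (q ^+ _); lia.
have -> : ((n.+1 + J).+3 = n.+2 + J.+2)%N by lia.
rewrite (bin2S J.+2) (bin2S J.+1) !exprD hn !(exprS (-1)) (exprS q J.+1).
ring.
Qed.

(** This is the finite Jacobi triple product differentiated at z = 1 and multiplied by
    [qprod 1 n.+1]; the proof is again an induction by telescoping. *)
Lemma jacobi_finite n :
  \sum_(j < n.+1) jacobi_term n j *+ (2 * j + 1) = qprod 1 n.+1 ^+ 3.
Proof.
elim: n => [|n IH].
  rewrite big_ord_recr big_ord0 /= /jacobi_term /jacobi_coef /= !qprod_nil //.
  rewrite bin_small //; ring.
case: n IH => [|n] IH.
  rewrite !big_ord_recr big_ord0 /= /jacobi_term /jacobi_coef /qprod.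
  rewrite unlock /= bin_small //=; ring.
rewrite big_ord_recr /= jacobi_term_telescope // IH (@qprod_recr 1 n.+2) // exprMn.
(* In the boundary term at [J = n.+1], the part of index [n.+2] is zero and the part of index [n.+1]
   cancels the new top summand. *)
have c0 : jacobi_coef n.+1 n.+2 = 0 by rewrite /jacobi_coef subnn qprod0 // mul0r.
have c1 : jacobi_coef n.+2 n.+2 = (1 - q ^+ n.+2) * jacobi_coef n.+1 n.+1.
  rewrite /jacobi_coef subSnn subSnn qprod_recr // !(@qprod_nil (_ + _).+2) //; ring.
rewrite /jacobi_term c0 c1 (bin2S n.+2) exprD (exprS (-1) n.+1).
ring.
Qed.
End FiniteIdentities.

(** * Congruences modulo a power of q *)

Section Congruence.
Variables (R : comNzRingType) (q : R).

Definition congq (N : nat) (a b : R) : Prop := exists u, a = b + q ^+ N * u.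

Lemma congq_refl N a : congq N a a.
Proof. by exists 0; rewrite mulr0 addr0. Qed.

Lemma congq_sym N a b : congq N a b -> congq N b a.
Proof. by case=> u ->; exists (- u); ring. Qed.

Lemma congq_trans N b a c : congq N a b -> congq N b c -> congq N a c.
Proof. by case=> u -> [v ->]; exists (u + v); ring. Qed.

Lemma congqD N a b c e : congq N a b -> congq N c e -> congq N (a + c) (b + e).
Proof. by case=> u -> [v ->]; exists (u + v); ring. Qed.

Lemma congqM N a b c e : congq N a b -> congq N c e -> congq N (a * c) (b * e).
Proof. by case=> u -> [v ->]; exists (u * e + b * v + q ^+ N * u * v); ring. Qed.

Lemma congqMn N a b k : congq N a b -> congq N (a *+ k) (b *+ k).
Proof. by case=> u ->; exists (u *+ k); rewrite mulrnDl mulrnAr. Qed.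

Lemma congqX N a b k : congq N a b -> congq N (a ^+ k) (b ^+ k).
Proof.
move=> ab; elim: k => [|k IH]; first exact: congq_refl.
by rewrite !exprS; apply: congqM.
Qed.

Lemma congq_leq N M a b : (N <= M)%N -> congq M a b -> congq N a b.
Proof. by move=> NM [u ->]; exists (q ^+ (M - N) * u); rewrite mulrA -exprD subnKC. Qed.

Lemma congq_sum (I : Type) (r : seq I) (P : pred I) N (f g : I -> R) :
  (forall i, P i -> congq N (f i) (g i)) ->
  congq N (\sum_(i <- r | P i) f i) (\sum_(i <- r | P i) g i).
Proof.
move=> fg; elim/big_rec2: _ => [|i a b Pi ab]; first exact: congq_refl.
by apply: congqD => //; apply: fg.
Qed.

Lemma congq0 N M c : (N <= M)%N -> congq N (c * q ^+ M) 0.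
Proof. by move=> NM; exists (c * q ^+ (M - N)); rewrite add0r mulrCA -exprD subnKC. Qed.

Lemma congq0_sum (I : eqType) (r : seq I) (P : pred I) N (f : I -> R) :
  (forall i, i \in r -> P i -> congq N (f i) 0) ->
  congq N (\sum_(i <- r | P i) f i) 0.
Proof.
move=> f0; rewrite big_seq_cond; elim/big_rec: _ => [|i x /andP[ir Pi] x0].
  exact: congq_refl.
by rewrite -[0]addr0; apply: congqD => //; apply: f0.
Qed.

(** Lets two finite truncations of one double series be compared without matching their index
    ranges. *)
Lemma congq_sum_support (I : eqType) (r s : seq I) N (f : I -> R) :
  uniq r -> uniq s -> {in r, forall i, i \notin s -> congq N (f i) 0} ->
  {in s, forall i, i \notin r -> congq N (f i) 0} ->
  congq N (\sum_(i <- r) f i) (\sum_(i <- s) f i).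
Proof.
move=> ur us f0r f0s.
rewrite (bigID (mem s)) [X in congq _ _ X](bigID (mem r)) /=.
apply: congqD.
  rewrite -big_filter -[X in congq _ _ X]big_filter (perm_big (filter (mem r) s)).
    exact: congq_refl.
  apply: uniq_perm; rewrite ?filter_uniq // => i.
  by rewrite !mem_filter /= andbC.
by apply: (@congq_trans _ 0); [|apply: congq_sym]; apply: congq0_sum.
Qed.

Lemma qprod_cong1 a b : congq a (qprod q a b) 1.
Proof.
rewrite /qprod big_seq_cond; elim/big_rec: _ => [|i x]; first exact: congq_refl.
rewrite mem_index_iota => /andP[/andP[ai _] _] xE.
rewrite -[X in congq _ _ X]mul1r; apply: congqM => //.
by apply: congq_sym; exists (q ^+ (i - a)); rewrite -exprD subnKC // subrK.
Qed.

Lemma qprod_cong_widen a b c : (a <= b)%N -> (b <= c)%N ->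
  congq b (qprod q a c) (qprod q a b).
Proof.
move=> ab bc; rewrite /qprod (big_cat_nat ab bc) /= -[X in congq _ _ X]mulr1.
by apply: congqM; [exact: congq_refl | exact: qprod_cong1].
Qed.

Lemma euler_cong n : congq n.+1 (qprod q 1 n.+1)
  (\sum_(i < n.+1) (-1) ^+ i * q ^+ (i * i + 'C(i.+1, 2))
    + \sum_(i < n) (-1) ^+ i.+1 * q ^+ (i.+1 * i.+1 + 'C(i.+1, 2))).
Proof.
rewrite -euler_finite big_ord_recl /euler_term expr0 mul0n mul1r bin_small // expr0 mul1r.
apply: congq_sym; rewrite -[X in congq _ _ X]addr0.
apply: congqD; first exact: congq_refl.
apply: congq0_sum => i _ _; rewrite mulrAC; apply: congq0.
by rewrite lift0 (bin2S i.+1); lia.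
Qed.

(** Since 1 - q^(2i) = (1 - q^i)(1 + q^i), multiplying [gauss_finite] by [qprod q 1 n.+1] gives
    Gauss's series for f_1^2 / f_2 without division. *)
Lemma gauss_cong n : congq n.+1 (qprod q 1 n.+1 ^+ 2)
  (qprod (q ^+ 2) 1 n.+1 * (\sum_(i < n.+1) (-1) ^+ i * q ^+ (i * i)
      + \sum_(i < n) (-1) ^+ i.+1 * q ^+ (i.+1 * i.+1))).
Proof.
have -> : qprod (q ^+ 2) 1 n.+1 = qprod q 1 n.+1 * qprodN q 1 n.+1.
  rewrite /qprod /qprodN -big_split /=; apply: eq_bigr => i _.
  by rewrite -exprM mulnC exprM; ring.
rewrite -mulrA -gauss_finite expr2; apply: congqM; first exact: congq_refl.
apply: congq_sym; rewrite -[X in congq _ _ X]addr0.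
apply: congqD; first exact: congq_refl.
rewrite -sumrMnl; apply: congq0_sum => i _ _.
rewrite /gauss_term -mulr_natr.
have -> (a b c d e : R) : a * b * c * d * e = a * c * d * e * b by ring.
by apply: congq0; lia.
Qed.

(** The coefficient is 1 only modulo [q ^+ (n.+1 - j)]; the missing [j] powers come from
    ['C(j.+1, 2) >= j]. *)
Lemma jacobi_cong n : congq n.+1 (qprod q 1 n.+1 ^+ 3)
  (\sum_(j < n.+1) (-1) ^+ j * q ^+ 'C(j.+1, 2) *+ (2 * j + 1)).
Proof.
rewrite -jacobi_finite; apply: congq_sum => j _.
apply: congqMn.
rewrite /jacobi_term -[X in congq _ _ X]mulr1.
have [u ->] : congq (n.+1 - j) (jacobi_coef q n j) 1.
  rewrite -[X in congq _ _ X]mulr1; apply: congqM; first exact: qprod_cong1.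
  by apply: (congq_leq _ (qprod_cong1 _ _)); lia.
exists ((-1) ^+ j * q ^+ ('C(j.+1, 2) - j) * u).
have -> : ('C(j.+1, 2) = 'C(j.+1, 2) - j + j)%N by rewrite bin2S addnK.
have -> : q ^+ n.+1 = q ^+ (n.+1 - j) * q ^+ j.
  by rewrite -exprD subnK // ltnW.
rewrite addnK !exprD; ring.
Qed.
End Congruence.

(** * Bilateral series *)

(** This half-open interval is stable under m -> -1 - m, the symmetry of triangular numbers, which
    exchanges [Posz i] and [Negz i]. *)
Definition zrange (B : nat) : seq int :=
  [seq Posz i | i <- iota 0 B] ++ [seq Negz i | i <- iota 0 B].

Lemma mem_zrange B (m : int) : (m \in zrange B) = (- B%:Z <= m < B%:Z).
Proof.
have Pinj : injective Posz by move=> ? ? [].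
have Ninj : injective Negz by move=> ? ? [].
rewrite mem_cat; case: m => i.
  rewrite mem_map // mem_iota /= (_ : (Posz i \in map Negz _) = false) ?orbF; first lia.
  by apply/negbTE/mapP => -[].
rewrite (mem_map Ninj) mem_iota /= (_ : (Negz i \in map Posz _) = false); first lia.
by apply/negbTE/mapP => -[].
Qed.

Lemma zrange_uniq B : uniq (zrange B).
Proof.
rewrite cat_uniq !map_inj_uniq ?iota_uniq //; try by move=> ? ? [].
by rewrite andbT; apply/hasPn => _ /mapP[i _ ->]; apply/mapP => -[].
Qed.

Lemma big_zrange (V : nmodType) B (f : int -> V) :
  \sum_(i <- zrange B) f i = \sum_(i < B) f (Posz i) + \sum_(i < B) f (Negz i).
Proof.
by rewrite big_cat !big_map -{1 2}[B]subn0 -/(index_iota 0 B) !big_mkord.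
Qed.

Definition tri (m : int) : nat := `|m * (m + 1)|./2.
Definition pent (m : int) : nat := `|m * (3 * m + 1)|./2.

Lemma tri_doubled m : (tri m).*2%:Z = m * (m + 1).
Proof.
have e : odd `|m * (m + 1)| = false by rewrite abszM oddM; lia.
rewrite /tri even_halfK ?e //; nia.
Qed.

Lemma pent_doubled m : (pent m).*2%:Z = m * (3 * m + 1).
Proof.
have e : odd `|m * (3 * m + 1)| = false by rewrite abszM oddM; lia.
rewrite /pent even_halfK ?e //; nia.
Qed.

Lemma bin2_doubled i : (2 * 'C(i.+1, 2) = i.+1 * i)%N.
Proof. by rewrite -mul_bin_diag bin1. Qed.

Lemma triPosz i : tri (Posz i) = 'C(i.+1, 2).
Proof. by have := tri_doubled i; have := bin2_doubled i; nia. Qed.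

Lemma triNegz i : tri (Negz i) = 'C(i.+1, 2).
Proof. by have := tri_doubled (Negz i); have := bin2_doubled i; nia. Qed.

Section Bilateral.
Variables (R : comNzRingType) (q : R).

Definition zsign (m : int) : R := (-1) ^+ `|m|.

Lemma zsignD m n : zsign (m + n) = zsign m * zsign n.
Proof.
rewrite /zsign -[LHS]signr_odd -[X in X * _]signr_odd -[X in _ * X]signr_odd.
by rewrite -signr_addb; congr (_ ^+ nat_of_bool _); lia.
Qed.

Lemma zsignN m : zsign (- m) = zsign m.
Proof. by rewrite /zsign abszN. Qed.

Lemma zsignS i : zsign (Negz i) = - zsign (Posz i).
Proof. by rewrite /zsign exprS mulN1r. Qed.

Lemma gauss_bilateral n : congq q n.+1 (qprod q 1 n.+1 ^+ 2)
  (qprod (q ^+ 2) 1 n.+1 * \sum_(j <- zrange n.+1) zsign j * q ^+ (`|j| * `|j|)).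
Proof.
apply: (congq_trans (gauss_cong _ _)); apply: congqM; first exact: congq_refl.
rewrite big_zrange; apply: congqD; first exact: congq_refl.
(* The bilateral range has the extra index -(n+1), whose term is a multiple of [q ^+ n.+1]. *)
rewrite [X in congq _ _ _ X]big_ord_recr /= -[X in congq _ _ X _]addr0.
apply: congqD; first exact: congq_refl.
by apply/congq_sym/congq0; lia.
Qed.

Lemma euler_bilateral n : congq q n.+1 (qprod q 1 n.+1)
  (\sum_(j <- zrange n.+1) zsign j * q ^+ pent j).
Proof.
apply: (congq_trans (euler_cong _ _)); rewrite big_zrange; apply: congqD.
  apply: congq_sum => i _; rewrite (_ : pent i = i * i + 'C(i.+1, 2))%N.
    exact: congq_refl.
  by have := pent_doubled i; have := bin2_doubled i; nia.
have pN i : pent (Negz i) = (i.+1 * i.+1 + 'C(i.+1, 2))%N.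
  by have := pent_doubled (Negz i); have := bin2_doubled i; nia.
rewrite [X in congq _ _ _ X]big_ord_recr /= -[X in congq _ _ X _]addr0.
apply: congqD; last by apply/congq_sym/congq0; rewrite pN; lia.
by apply: congq_sum => i _; rewrite pN; exact: congq_refl.
Qed.

(** The indices i and -1 - i share their triangular number and have opposite signs, so their factors
    combine to i + (i + 1). *)
Lemma jacobi_bilateral n : congq q n.+1 (qprod q 1 n.+1 ^+ 3)
  (\sum_(m <- zrange n.+1) zsign m * q ^+ tri m * m%:~R).
Proof.
rewrite big_zrange -big_split /=; apply: (congq_trans (jacobi_cong _ _)).
apply: congq_sum => i _; rewrite triPosz triNegz zsignS.
set c := q ^+ _.
have -> : zsign i * c * i%:~R + - zsign i * c * (Negz i)%:~R
    = (-1) ^+ i * c *+ (2 * i + 1); last exact: congq_refl.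
rewrite /zsign absz_nat NegzE mulrNz -!pmulrn; ring.
Qed.

Lemma sum_zsign_tri B : \sum_(m <- zrange B) zsign m * q ^+ tri m = 0.
Proof.
rewrite big_zrange -big_split /= big1 // => i _.
by rewrite triPosz triNegz zsignS mulNr subrr.
Qed.
End Bilateral.

(** * The series of f_1^5 / f_2^2 *)

Definition zsquare (B : nat) (phi : int -> int -> int * int) : seq (int * int) :=
  [seq phi j n | j <- zrange B, n <- zrange B].

Lemma zsquare_uniq B phi : injective (fun x : int * int => phi x.1 x.2) ->
  uniq (zsquare B phi).
Proof.
move=> inj; apply: allpairs_uniq; rewrite ?zrange_uniq //.
by move=> [a b] [c e] _ _ /= /(inj (a, b) (c, e)).
Qed.

Lemma mem_zsquare B phi j n : - B%:Z <= j < B%:Z -> - B%:Z <= n < B%:Z ->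
  phi j n \in zsquare B phi.
Proof. by move=> hj hn; apply: allpairs_f; rewrite mem_zrange. Qed.

(* The three maps parametrize the pairs [(m, n)] according to the residue of
   [m + 2 * n] modulo 3. *)
Definition residue0 (j n : int) : int * int := (j + 2 * n, j - n).
Definition residue1 (j n : int) : int * int := (j + 1 + 2 * n, j - n).
Definition residue2 (j n : int) : int * int := (- 1 - j - 2 * n, n - j).

Definition zresidues (B : nat) : seq (int * int) :=
  zsquare B residue0 ++ zsquare B residue1 ++ zsquare B residue2.

Lemma zresidues_uniq B : uniq (zresidues B).
Proof.
rewrite !cat_uniq !zsquare_uniq; first last.
- by move=> [a b] [c e] /= [? ?]; congr pair; lia.
- by move=> [a b] [c e] /= [? ?]; congr pair; lia.
- by move=> [a b] [c e] /= [? ?]; congr pair; lia.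
rewrite andbT /=; apply/andP; split; last first.
  apply/hasPn => _ /allpairsP[[a b] /= [_ _ ->]].
  by apply/allpairsP => -[[c e] /= [_ _ []]]; lia.
apply/hasPn => x; rewrite mem_cat => /orP[] /allpairsP[[a b] /= [_ _ ->]];
  by apply/allpairsP => -[[c e] /= [_ _ []]]; lia.
Qed.

Definition weight (x : int * int) : nat := (tri x.1 + `|x.2| * `|x.2|)%N.

Lemma weight_bound x N : (weight x < N)%N ->
  - N%:Z - 1 <= x.1 <= N%:Z /\ - N%:Z <= x.2 <= N%:Z.
Proof.
case: x => m n; rewrite /weight /= => wN; have := tri_doubled m => tm.
split; nia.
Qed.

Lemma mem_zresidues x N : (weight x < N)%N -> x \in zresidues (3 * N).+3.
Proof.
case: x => m n /weight_bound /= [mN nN]; rewrite mem_cat [_ \in _ ++ zsquare _ residue2]mem_cat.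
pose j := ((m + 2 * n) %/ 3)%Z.
have : m + 2 * n = 3 * j \/ m + 2 * n = 3 * j + 1 \/ m + 2 * n = 3 * j + 2 by lia.
case=> [k0|[k1|k2]].
- have -> : (m, n) = residue0 j (j - n) by congr pair; lia.
  by rewrite (mem_zsquare residue0) //; lia.
- have -> : (m, n) = residue1 j (j - n) by congr pair; lia.
  by rewrite (mem_zsquare residue1) ?orbT //; lia.
(* On [residue2 a b] the form m + 2n equals -1 - 3a, which forces a = -j - 1 and b = n + a. *)
- have -> : (m, n) = residue2 (- j - 1) (n - j - 1) by congr pair; lia.
  by rewrite (mem_zsquare residue2) ?orbT //; lia.
Qed.

Section Combination.
Variables (R : comNzRingType) (q : R).

Definition theta_term (x : int * int) : R :=
  zsign R (x.1 + x.2) * (x.1 + 2 * x.2)%:~R * q ^+ weight x.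

(** Replacing Jacobi's factor m by m + 2n adds a multiple of the sum in [sum_zsign_tri], which is
    zero; m + 2n is the form that is constant in the second parameter of each residue map. *)
Lemma sum_theta_term B :
  \sum_(x <- zsquare B pair) theta_term x =
  (\sum_(m <- zrange B) zsign R m * q ^+ tri m * m%:~R)
  * (\sum_(n <- zrange B) zsign R n * q ^+ (`|n| * `|n|)).
Proof.
rewrite big_allpairs_dep.
transitivity ((\sum_(m <- zrange B) zsign R m * q ^+ tri m * m%:~R)
  * (\sum_(n <- zrange B) zsign R n * q ^+ (`|n| * `|n|))
  + (\sum_(m <- zrange B) zsign R m * q ^+ tri m)
  * (\sum_(n <- zrange B) zsign R n * q ^+ (`|n| * `|n|) * (2 * n)%:~R)).
  rewrite !mulr_suml -big_split /=; apply: eq_bigr => m _.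
  rewrite !mulr_sumr -big_split /=; apply: eq_bigr => n _.
  rewrite /theta_term /weight /= zsignD exprD rmorphD; ring.
by rewrite sum_zsign_tri mul0r addr0.
Qed.

(** For fixed [j], reflecting the second parameter by n -> -1 - n keeps both the linear factor 3j +
    1 and the weight, and flips the sign. *)
Lemma sum_theta_term_residue1 B : \sum_(x <- zsquare B residue1) theta_term x = 0.
Proof.
rewrite big_allpairs_dep /= big1 // => j _; rewrite big_zrange -big_split /= big1 // => i _.
have -> : theta_term (residue1 j (Negz i)) = - theta_term (residue1 j i).
  rewrite /theta_term /residue1 /=.
  have -> : j + 1 + 2 * Negz i + (j - Negz i) = (j + j) + 1 + Negz i by lia.
  have -> : j + 1 + 2 * i%:Z + (j - i%:Z) = (j + j) + 1 + i%:Z by lia.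
  have -> : j + 1 + 2 * Negz i + 2 * (j - Negz i) = j + 1 + 2 * i%:Z + 2 * (j - i%:Z) by lia.
  have -> : weight (j + 1 + 2 * Negz i, j - Negz i) = weight (j + 1 + 2 * i%:Z, j - i%:Z).
    rewrite /weight /=.
    have := tri_doubled (j + 1 + 2 * Negz i); have := tri_doubled (j + 1 + 2 * i%:Z).
    nia.
  by rewrite zsignD zsignS (zsignD _ _ (Posz i)); ring.
by rewrite addrC addNr.
Qed.

(** The substitution diagonalizes the quadratic form: the cross terms 2jn and -2jn cancel. *)
Lemma weight_residue0 j n : weight (residue0 j n) = (pent j + 2 * pent n)%N.
Proof.
rewrite /weight /residue0 /=.
by have := tri_doubled (j + 2 * n); have := pent_doubled j; have := pent_doubled n; nia.
Qed.

(** [residue2] is [residue0] followed by m -> -1 - m and n -> -n, which preserve the two parts of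
    the weight. *)
Lemma weight_residue2 j n : weight (residue2 j n) = (pent j + 2 * pent n)%N.
Proof.
rewrite -weight_residue0 /weight /residue0 /residue2 /=.
by have := tri_doubled (j + 2 * n); have := tri_doubled (- 1 - j - 2 * n); nia.
Qed.

(** Classes 0 and 2 contribute 3j and 3j + 1 with the same sign and weight, whence the coefficient
    6j + 1. *)
Lemma sum_theta_term_residues B :
  \sum_(x <- zresidues B) theta_term x =
  (\sum_(j <- zrange B) (6 * j + 1)%:~R * q ^+ pent j)
  * (\sum_(n <- zrange B) zsign R n * (q ^+ 2) ^+ pent n).
Proof.
rewrite big_cat [X in _ + X = _]big_cat /= sum_theta_term_residue1 add0r.
rewrite !big_allpairs_dep -big_split /=.
rewrite mulr_suml; apply: eq_bigr => j _.
rewrite mulr_sumr -big_split /=; apply: eq_bigr => n _.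
rewrite /theta_term weight_residue0 weight_residue2 /residue0 /residue2 /=.
have -> : j + 2 * n + (j - n) = (j + j) + n by lia.
have -> : - 1 - j - 2 * n + (n - j) = - (j + j + (n + 1)) by lia.
have -> : - 1 - j - 2 * n + 2 * (n - j) = - (3 * j + 1) by lia.
have -> : j + 2 * n + 2 * (j - n) = 3 * j by lia.
rewrite zsignN !zsignD -!expr2 /zsign !sqrr_sign expr1 exprD exprM.
rewrite rmorphN !rmorphD !rmorphM /=; ring.
Qed.

Lemma theta_product N : let B := (3 * N).+3 in
  congq q N
    ((\sum_(m <- zrange B) zsign R m * q ^+ tri m * m%:~R)
     * (\sum_(n <- zrange B) zsign R n * q ^+ (`|n| * `|n|)))
    ((\sum_(j <- zrange B) (6 * j + 1)%:~R * q ^+ pent j)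
     * (\sum_(n <- zrange B) zsign R n * (q ^+ 2) ^+ pent n)).
Proof.
move=> B; rewrite -sum_theta_term -sum_theta_term_residues.
have small x : (weight x < N)%N || (N <= weight x)%N by rewrite ltnNge orNb.
apply: congq_sum_support; [|exact: zresidues_uniq| |].
- by apply: zsquare_uniq => -[a b] [c e].
- move=> x _ xB; case/orP: (small x) => [/mem_zresidues|]; last exact: congq0.
  by rewrite (negbTE xB).
- move=> [m n] _ xB; case/orP: (small (m, n)) => [/weight_bound/= [mN nN]|]; last exact: congq0.
  by move: xB; rewrite (mem_zsquare pair) // /B; lia.
Qed.

(** Jacobi's and Gauss's series give one factor f_2 and a double series; [theta_product] and Euler's
    series at [q ^+ 2] extract the second f_2. *)
Theorem qprod_ratio N : let B := (3 * N).+3 in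
  congq q N (qprod q 1 B ^+ 5)
    (qprod (q ^+ 2) 1 B ^+ 2 * \sum_(j <- zrange B) (6 * j + 1)%:~R * q ^+ pent j).
Proof.
move=> B; set G := \sum_(_ <- _) _.
have lift_cong a b : congq q B a b -> congq q N a b by apply: congq_leq; lia.
have hE : congq q N (qprod (q ^+ 2) 1 B) (\sum_(n <- zrange B) zsign R n * (q ^+ 2) ^+ pent n).
  have [u ->] := euler_bilateral (q ^+ 2) (3 * N).+2.
  exists (q ^+ (B + B - N) * u); rewrite mulrA -exprD -exprM.
  by congr (_ + q ^+ _ * u); lia.
rewrite (exprD _ 3 2); apply: congq_trans.
  apply: congqM; apply: lift_cong; [exact: jacobi_bilateral | exact: gauss_bilateral].
rewrite mulrCA expr2 -mulrA; apply: congqM; first exact: congq_refl.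
apply: (congq_trans (theta_product N)); rewrite mulrC.
by apply: congqM; [exact: congq_sym | exact: congq_refl].
Qed.
End Combination.

(** * Reduction modulo p *)

Definition geom (R : comNzRingType) (a : R) (n : nat) : R := \sum_(j < n) (1 - a) ^+ j.

(** The product telescopes to [1 - (1 - a) ^+ n], and [q] divides [1 - a]. *)
Lemma geom_inverse (R : comNzRingType) (q a : R) n :
  congq q 1 a 1 -> congq q n (a * geom a n) 1.
Proof.
have telescope x : (1 - x) * geom (1 - x) n = 1 - x ^+ n.
  by rewrite -[RHS]opprB subrX1 /geom subKr -mulNr opprB.
case=> u ->; exists (- (- u) ^+ n).
have {1 2}-> : 1 + q ^+ 1 * u = 1 - q * (- u) by ring.
by rewrite telescope exprMn mulrN.
Qed.

Lemma rmorph_geom (R S : comNzRingType) (f : {rmorphism R -> S}) a n :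
  f (geom a n) = geom (f a) n.
Proof. by rewrite rmorph_sum; apply: eq_bigr => j _; rewrite rmorphXn rmorphB rmorph1. Qed.

Lemma rmorph_qprod (R S : comNzRingType) (f : {rmorphism R -> S}) q a b :
  f (qprod q a b) = qprod (f q) a b.
Proof. by rewrite rmorph_prod; apply: eq_bigr => i _; rewrite rmorphB rmorph1 rmorphXn. Qed.

Lemma fr_truncE r N : fr_trunc r N = qprod 'X^r 1 N.+1.
Proof. by apply: eq_bigr => i _; rewrite exprM. Qed.

Lemma congq_coef (R : comNzRingType) N (a b : {poly R}) :
  congq 'X N.+1 a b -> a`_N = b`_N.
Proof. by case=> u ->; rewrite coefD coefXnM ltnSn addr0. Qed.

Lemma congqXn (R : comNzRingType) (q a b : R) k N :
  (0 < k)%N -> congq (q ^+ k) N a b -> congq q N a b.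
Proof.
by move=> k0 [u ->]; rewrite -exprM; apply: (@congq_leq _ _ _ (k * N)); [nia | exists u].
Qed.

(** Only exponents divisible by [p] occur in [H \Po 'X^p], so a contributing [j] has [pent j]
    congruent to [N], and then [p] divides (6j+1)^2. *)
Lemma coef_pentagonal (p N : nat) (H : {poly 'F_p}) (s : seq int) : prime p ->
  (p %| 24 * N + 1)%N ->
  ((H \Po 'X^p) * \sum_(j <- s) (6 * j + 1)%:~R * 'X^(pent j))`_N = 0.
Proof.
move=> pp pN; rewrite mulr_sumr coef_sum big1 // => j _.
rewrite mulrCA -[_%:~R]/(1 *~ _) -(rmorph_int polyC) coefCM coefMXn.
case: ltnP => [_|jN]; first by rewrite mulr0.
rewrite coef_comp_poly_Xn ?prime_gt0 //; case: ifP => [pj|_]; last by rewrite mulr0.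
suff /eqP -> : (6 * j + 1)%:~R == 0 :> 'F_p by rewrite mul0r.
have ch : p \in [pchar 'F_p] by rewrite pchar_Fp.
rewrite -(dvdz_pcharf ch) dvdzE /=.
suff : (p %| `|(6 * j + 1)%R| ^ 2)%N by rewrite Euclid_dvdX // => /andP[].
have e : (`|(6 * j + 1)%R| ^ 2 + 24 * (N - pent j) = 24 * N + 1)%N.
  by have := pent_doubled j; rewrite -mulnn; nia.
by move: pN; rewrite -e dvdn_addl // dvdn_mull.
Qed.

Theorem theorem4p2 (p t : nat) :
  prime p -> (5 <= p)%N ->
  (1 <= t <= p - 1)%N -> (p %| 24 * t + 1)%N ->
  forall n : nat, (p%:Z %| d (p - 2) (p * n + t))%Z.
Proof.
move=> pp p5 _ pt n; set N := (p * n + t)%N.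
have ch : p \in [pchar 'F_p] by rewrite pchar_Fp.
have chX : p \in [pchar {poly 'F_p}] by rewrite pchar_poly.
have pN : (p %| 24 * N + 1)%N.
  by rewrite /N mulnDr -addnA dvdn_addr // mulnCA dvdn_mulr.
rewrite (dvdz_pcharf ch) /d -/(geom _ _) !fr_truncE.
rewrite -(coef_map (intr : {rmorphism int -> 'F_p})) /=.
rewrite rmorphM rmorphXn rmorph_geom rmorphXn !rmorph_qprod !rmorphXn /= map_polyX expr1.
pose f1 : {poly 'F_p} := qprod 'X 1 N.+1; pose f2 : {poly 'F_p} := qprod 'X^2 1 N.+1.
rewrite -/f1 -/f2; set V := geom _ _.
have f1_1 : congq 'X 1 f1 1 := qprod_cong1 _ _ _.
have VE : congq 'X N.+1 (f1 ^+ (3 * (p - 2) + 1) * V) 1.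
  by apply: geom_inverse; rewrite -(expr1n _ (3 * (p - 2) + 1)); apply: congqX.
pose B := (3 * N.+1).+3; pose G : {poly 'F_p} := \sum_(j <- zrange B) (6 * j + 1)%:~R * 'X^(pent j).
have f15 : congq 'X N.+1 (f1 ^+ 5) (f2 ^+ 2 * G).
  (* [qprod_ratio] concerns products up to [B]; the factors beyond [N] do not matter modulo
     ['X ^+ N.+1]. *)
  apply: (congq_trans (b := qprod 'X 1 B ^+ 5)).
    by apply/congqX/congq_sym/qprod_cong_widen; rewrite /B; lia.
  apply: (congq_trans (qprod_ratio _ _)); apply: congqM; last exact: congq_refl.
  by apply/congqX/(@congqXn _ _ _ _ 2) => //; apply: qprod_cong_widen; lia.
pose g1 : {poly 'F_p} := qprod 'X 1 N.+1 ^+ 3; pose g2 : {poly 'F_p} := qprod 'X^2 1 N.+1.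
(* The [p]-th power is a ring morphism here, so it only replaces [q] by [q ^+ p]. *)
have frob (q : {poly 'F_p}) a b : qprod q a b ^+ p = qprod (q ^+ p) a b.
  by rewrite -(pFrobenius_autE chX) rmorph_qprod.
have f1p : f1 ^+ (3 * p) = g1 \Po 'X^p.
  rewrite mulnC exprM /f1 frob rmorphXn /= (rmorph_qprod (comp_poly 'X^p)) /=.
  by rewrite comp_polyX.
have f2p : f2 ^+ p = g2 \Po 'X^p.
  by rewrite /f2 frob (rmorph_qprod (comp_poly 'X^p)) rmorphXn /= comp_polyX -!exprM mulnC.
pose W := geom (f1 ^+ (3 * p)) N.+1.
have WE : congq 'X N.+1 (f1 ^+ (3 * p) * W) 1.
  by apply: geom_inverse; rewrite -(expr1n _ (3 * p)); apply: congqX.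
have main : congq 'X N.+1 (f2 ^+ (p - 2) * V) (((g2 * geom g1 N.+1) \Po 'X^p) * G).
  rewrite rmorphM (rmorph_geom (comp_poly 'X^p)) /= -f1p -f2p -/W.
  (* Insert [f1 ^+ (3 * p) * W], congruent to 1. Of the exponent 3p = (3(p-2) + 1) + 5, the first
     part cancels [V] and [f1 ^+ 5] becomes [f2 ^+ 2 * G], completing [f2 ^+ p]. *)
  apply: (congq_trans (b := f2 ^+ (p - 2) * V * (f1 ^+ (3 * p) * W))).
    rewrite -[X in congq _ _ X]mulr1; apply: congqM; first exact: congq_refl.
    exact: congq_sym.
  have -> : (3 * p = 3 * (p - 2) + 1 + 5)%N by lia.
  rewrite exprD; set x := f1 ^+ (_ + 1).
  have -> : f2 ^+ (p - 2) * V * (x * f1 ^+ 5 * W) = f2 ^+ (p - 2) * W * ((x * V) * f1 ^+ 5) by ring.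
  have -> : f2 ^+ p * W * G = f2 ^+ (p - 2) * W * (1 * (f2 ^+ 2 * G)).
    have -> : f2 ^+ p = f2 ^+ (p - 2) * f2 ^+ 2 by rewrite -exprD; congr (_ ^+ _); lia.
    ring.
  by do 2! (apply: congqM => //; try exact: congq_refl).
by rewrite (congq_coef main) coef_pentagonal.
Qed.
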